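(* The Lamplighter group $L=\mathbb{Z}_2\wr\mathbb{Z}$ is a condensation group.
   Context: $\mathbb{Z}_2\wr\mathbb{Z}$ is the restricted wreath product $\left(\bigoplus_{\mathbb{Z}}\mathbb{Z}_2\right)\rtimes\mathbb{Z}$ with $\mathbb{Z}$ acting by shifting coordinates; $\mathbb{Z}_2=\mathbb{Z}/2\mathbb{Z}$. For $k\ge 1$, $\mathcal{M}_k$ is the space of marked $k$-generated groups: its points are pairs $(G,S)$ where $G$ is a group and $S=(s_1,\dots,s_k)$ is an ordered tuple of (not necessarily distinct) elements generating $G$; $(G,S)$ and $(H,T)$ are identified when $s_i\mapsto t_i$ ($i=1,\dots,k$) extends to an isomorphism $G\to H$. Two points are at distance $\le 2^{-N}$ if the balls of radius $N$ around the identity in the (labelled) Cayley graphs of $(G,S)$ and $(H,T)$ are isomorphic. With this ultrametric $\mathcal{M}_k$ is compact, totally disconnected and separable; a sequence $(G_n,S_n)$ converges to $(G,S)$ if and only if for every $w$ in the free group $F_k$ there is $N_w$ such that for all $n\ge N_w$: $w=1$ holds in $G$ if and only if $w=1$ holds in $G_n$. The perfect kernel (condensation part) $\kappa(X)$ of a Polish space $X$ is the set of points all of whose open neighborhoods are uncountable (equivalently, the stable term of the transfinite Cantor–Bendixson derivative sequence). A finitely generated group $G$ is a condensation group if for some generating tuple $S$ of some size $k$ the point $(G,S)$ belongs to $\kappa(\mathcal{M}_k)$ (this does not depend on the choice of $S$). *)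

(* Defs.v *)
From HB Require Import structures.
From mathcomp Require Import all_boot all_order all_algebra.
From mathcomp Require Import all_classical.
From mathcomp Require Import topology.
Set Implicit Arguments.
Unset Strict Implicit.
Unset Printing Implicit Defensive.

Local Open Scope classical_set_scope.
Local Open Scope group_scope.
Local Open Scope quotient_scope.

Definition generates (G : groupType) (k : nat) (s : 'I_k -> G) : Prop :=
  forall A : {pred G}, group_closed A -> (forall i, s i \in A) ->
    forall g, g \in A.

Definition marked_iso (k : nat) (G H : groupType)
    (s : 'I_k -> G) (t : 'I_k -> H) : Prop :=
  exists f : G -> H,
    [/\ bijective f, {morph f : g h / g * h} & forall i, f (s i) = t i].

(* The carrier is taken in [Set], as the type of all [groupType]s is too large
   to be a [choiceType]. Nothing is lost: a finitely generated group is
   countable, hence isomorphic to one carried by a small type, see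
   [marked_group_exists]. *)
Record marked_group (k : nat) : Type := MarkedGroup {
  mg_sort : Set;
  mg_class : Group.axioms_ mg_sort;
  mg_gen : 'I_k -> Group.Pack mg_class;
  mg_generates : generates mg_gen
}.

Definition mg_group k (x : marked_group k) : groupType :=
  Group.Pack (mg_class x).
Coercion mg_group : marked_group >-> Group.type.

HB.instance Definition _ k := gen_eqMixin (marked_group k).
HB.instance Definition _ k := gen_choiceMixin (marked_group k).

(* The letter (i, false) stands for s_i and (i, true) for its inverse; a word
   is a possibly unreduced element of the free group F_k. *)
Definition letter (G : groupType) k (s : 'I_k -> G) (l : 'I_k * bool) : G :=
  if l.2 then (s l.1)^-1 else s l.1.

Definition word_val (G : groupType) k (s : 'I_k -> G)
    (w : seq ('I_k * bool)) : G :=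
  \prod_(l <- w) letter s l.

Definition cayley_ball k (x : marked_group k) (N : nat) : set x :=
  [set g | exists2 w : seq ('I_k * bool),
             (size w <= N)%N & g = word_val (@mg_gen k x) w].
Arguments cayley_ball {k} x N _.

Definition cayley_edge k (x : marked_group k) (i : 'I_k) (g h : x) : Prop :=
  h = g * mg_gen x i.
Arguments cayley_edge {k} x i g h.

(* Isomorphism of the balls of radius N around the identity, as rooted graphs
   with directed edges labelled by the generators; a ball carries the induced
   subgraph structure. *)
Definition ball_iso k (N : nat) (x y : marked_group k) : Prop :=
  exists f : x -> y,
    [/\ set_bij (cayley_ball x N) (cayley_ball y N) f,
        f 1 = 1 &
        forall i g h, cayley_ball x N g -> cayley_ball x N h ->
          (cayley_edge x i g h <-> cayley_edge y i (f g) (f h))].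

Section MarkedIso.
Variable k : nat.

Lemma marked_iso_refl (G : groupType) (s : 'I_k -> G) : marked_iso s s.
Proof. by exists id; split=> //; exists id. Qed.

Lemma marked_iso_sym (G H : groupType) (s : 'I_k -> G) (t : 'I_k -> H) :
  marked_iso s t -> marked_iso t s.
Proof.
move=> [f [[g fK gK] fM fs]]; exists g; split.
- by exists f.
- by move=> a b; apply: (can_inj fK); rewrite fM !gK.
- by move=> i; rewrite -fs fK.
Qed.

Lemma marked_iso_trans (G H K : groupType)
    (s : 'I_k -> G) (t : 'I_k -> H) (u : 'I_k -> K) :
  marked_iso s t -> marked_iso t u -> marked_iso s u.
Proof.
move=> [f [fb fM fs]] [g [gb gM gs]]; exists (g \o f); split.
- exact: bij_comp.
- by move=> a b /=; rewrite fM gM.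
- by move=> i /=; rewrite fs gs.
Qed.

Definition marked_rel (x y : marked_group k) : bool :=
  `[< marked_iso (@mg_gen k x) (@mg_gen k y) >].

Lemma marked_rel_refl : reflexive marked_rel.
Proof. by move=> x; apply/asboolP; exact: marked_iso_refl. Qed.

Lemma marked_rel_sym : symmetric marked_rel.
Proof.
by move=> x y; apply/asboolP/asboolP; exact: marked_iso_sym.
Qed.

Lemma marked_rel_trans : transitive marked_rel.
Proof.
move=> y x z /asboolP xy /asboolP yz; apply/asboolP.
exact: marked_iso_trans xy yz.
Qed.

Definition marked_equiv : equiv_rel (marked_group k) :=
  EquivRel marked_rel marked_rel_refl marked_rel_sym marked_rel_trans.

End MarkedIso.

Section BallIso.
Variable k : nat.
Implicit Types x y z : marked_group k.

Lemma cayley_ball_mono x m n : (m <= n)%N ->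
  cayley_ball x m `<=` cayley_ball x n.
Proof. by move=> mn g [w wm ->]; exists w => //; exact: leq_trans mn. Qed.

Lemma word_val_rcons (G : groupType) (s : 'I_k -> G) w l :
  word_val s (rcons w l) = word_val s w * letter s l.
Proof. by rewrite /word_val big_rcons. Qed.

Lemma word_val_cayley_ball x N (w : seq ('I_k * bool)) :
  (size w <= N)%N -> cayley_ball x N (word_val (@mg_gen k x) w).
Proof. by move=> wN; exists w. Qed.

Lemma ball_iso_word N x y (f : x -> y) : f 1 = 1 ->
  (forall i g h, cayley_ball x N g -> cayley_ball x N h ->
     (cayley_edge x i g h <-> cayley_edge y i (f g) (f h))) ->
  forall w, (size w <= N)%N ->
    f (word_val (@mg_gen k x) w) = word_val (@mg_gen k y) w.
Proof.
move=> f1 fE; elim/last_ind => [|w [i b] IH].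
  by rewrite /word_val !big_nil.
rewrite size_rcons => wN; have wN' := ltnW wN.
have B1 := word_val_cayley_ball x wN'.
have B2 : cayley_ball x N (word_val (@mg_gen k x) (rcons w (i, b))).
  by apply: word_val_cayley_ball; rewrite size_rcons.
move: B2; rewrite !word_val_rcons -IH // /letter /=; case: b => B2.
  have /(fE i _ _ B2 B1) : cayley_edge x i
      (word_val (@mg_gen k x) w * (mg_gen x i)^-1) (word_val (@mg_gen k x) w).
    by rewrite /cayley_edge mulgVK.
  by rewrite /cayley_edge => ->; rewrite mulgK.
by have /(fE i _ _ B1 B2) : cayley_edge x i (word_val (@mg_gen k x) w)
      (word_val (@mg_gen k x) w * mg_gen x i).
Qed.

Lemma ball_iso_mono m n x y : (m <= n)%N -> ball_iso n x y -> ball_iso m x y.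
Proof.
move=> mn [f [[_ fI _] f1 fE]].
have sub := @cayley_ball_mono _ _ _ mn.
have fw w : (size w <= m)%N ->
    f (word_val (@mg_gen k x) w) = word_val (@mg_gen k y) w.
  by move=> wm; apply: (ball_iso_word f1 fE); exact: leq_trans mn.
exists f; split => //; last first.
  by move=> i g h /sub Bg /sub Bh; exact: fE.
split.
- by move=> _ [w wm ->]; exists w => //; exact: fw.
- by move=> g h; rewrite !inE => /sub Bg /sub Bh; apply: fI; rewrite inE.
- by move=> _ [w wm ->]; exists (word_val (@mg_gen k x) w); [exists w|exact: fw].
Qed.

Lemma ball_iso_refl N x : ball_iso N x x.
Proof. by exists id; split=> //; split=> // g Bg; exists g. Qed.

Lemma ball_iso_sym N x y : ball_iso N x y -> ball_iso N y x.
Proof.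
move=> [f [[fF fI fS] f1 fE]].
have B1 (z : marked_group k) : cayley_ball z N 1.
  by exists [::] => //; rewrite /word_val big_nil.
pose g (h : y) : x := xget 1 [set a | cayley_ball x N a /\ f a = h].
have gP h : cayley_ball y N h -> cayley_ball x N (g h) /\ f (g h) = h.
  move=> /fS [a Ba fa]; rewrite /g; case: xgetP => [b -> //|/(_ a)].
  by case; split.
have fI' a b : cayley_ball x N a -> cayley_ball x N b -> f a = f b -> a = b.
  by move=> Ba Bb; apply: fI; rewrite inE.
exists g; split.
- split.
  + by move=> h /gP[].
  + move=> a b; rewrite !inE => /gP[_ ga] /gP[_ gb] gab.
    by rewrite -ga -gb gab.
  + move=> a Ba; have Bfa := fF _ Ba; exists (f a) => //.
    by have [Bg fg] := gP _ Bfa; exact: fI'.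
- by have [Bg fg] := gP _ (B1 y); apply: fI' => //; rewrite fg f1.
- move=> i a b /gP[Ba fa] /gP[Bb fb].
  by rewrite -{1}fa -{1}fb; apply: iff_sym; exact: fE.
Qed.

Lemma ball_iso_trans N x y z : ball_iso N x y -> ball_iso N y z ->
  ball_iso N x z.
Proof.
move=> [f [fb f1 fE]] [g [gb g1 gE]]; exists (g \o f); split.
- exact: set_bij_comp fb gb.
- by rewrite /= f1 g1.
- move=> i a b Ba Bb; apply: (iff_trans (fE i a b Ba Bb)).
  by case: fb => fF _ _; apply: gE; exact: fF.
Qed.

Lemma marked_iso_ball_iso N x y :
  marked_iso (@mg_gen k x) (@mg_gen k y) -> ball_iso N x y.
Proof.
move=> [f [fb fM fs]].
have f1 : f 1 = 1 by apply: (mulgI (f 1)); rewrite -fM !mulg1.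
have fE i g h : cayley_edge x i g h <-> cayley_edge y i (f g) (f h).
  rewrite /cayley_edge -fs -fM; split=> [->//|]; exact: (bij_inj fb).
have fw w : f (word_val (@mg_gen k x) w) = word_val (@mg_gen k y) w.
  by apply: (@ball_iso_word (size w)).
exists f; split=> //; split.
- by move=> _ [w wm ->]; exists w.
- by move=> g h _ _; exact: (bij_inj fb).
- by move=> _ [w wm ->]; exists (word_val (@mg_gen k x) w); [exists w|].
Qed.

End BallIso.

Section SmallModel.
Variables (k : nat) (G : groupType) (s : 'I_k -> G).
Hypothesis sG : generates s.

(* The words below are over [nat], as ['I_k] is not in [Set]. *)
Let code_val (w : seq (nat * bool)) : G :=
  \prod_(l <- w)
    if insub l.1 is Some i then letter s (i, l.2) else 1.

Let code_surj g : exists w, code_val w = g.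
Proof.
pose A : {pred G} := fun g => `[< exists w, code_val w = g >].
suff /asboolP : g \in A by [].
apply: sG; last first.
  move=> i; apply/asboolP; exists [:: (val i, false)].
  by rewrite /code_val big_seq1 /= valK.
split; first by apply/asboolP; exists [::]; rewrite /code_val big_nil.
move=> _ _ /asboolP[u <-] /asboolP[v <-]; apply/asboolP.
exists (u ++ rev [seq (l.1, ~~ l.2) | l <- v]).
rewrite {1}/code_val big_cat /=; congr (_ * _).
elim: v => [|[n b] v IH]; first by rewrite /code_val !big_nil invg1.
rewrite /= rev_cons big_rcons /= IH /code_val big_cons /= invgM.
congr (_ * _); case: insubP => [i _ _|_]; last by rewrite invg1.
by rewrite /letter; case: b; rewrite //= invgK.
Qed.

Let code (g : G) : seq (nat * bool) := sval (cid (code_surj g)).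

Let codeK g : code_val (code g) = g.
Proof. by rewrite /code; case: cid. Qed.

Definition small_model : Set :=
  {w : seq (nat * bool) | code (code_val w) == w}.

HB.instance Definition _ := Choice.on small_model.

Let dec (w : small_model) : G := code_val (sval w).

Let enc_proof g : code (code_val (code g)) == code g.
Proof. by rewrite codeK. Qed.

Let enc (g : G) : small_model := exist _ (code g) (enc_proof g).

Let encK : cancel enc dec.
Proof. by move=> g; rewrite /dec /= codeK. Qed.

Let decK : cancel dec enc.
Proof. by move=> w; apply: val_inj => /=; apply/eqP; case: w. Qed.

Let sm_mul (a b : small_model) := enc (dec a * dec b).
Let sm_one := enc 1.
Let sm_inv (a : small_model) := enc (dec a)^-1.

Let sm_mulA : associative sm_mul.
Proof. by move=> a b c; rewrite /sm_mul !encK mulgA. Qed.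
Let sm_mul1 : left_id sm_one sm_mul.
Proof. by move=> a; rewrite /sm_mul encK mul1g decK. Qed.
Let sm_1mul : right_id sm_one sm_mul.
Proof. by move=> a; rewrite /sm_mul encK mulg1 decK. Qed.
Let sm_mulV : left_inverse sm_one sm_inv sm_mul.
Proof. by move=> a; rewrite /sm_mul encK mulVg. Qed.
Let sm_Vmul : right_inverse sm_one sm_inv sm_mul.
Proof. by move=> a; rewrite /sm_mul encK mulgV. Qed.

HB.instance Definition _ := isGroup.Build small_model
  sm_mulA sm_mul1 sm_1mul sm_mulV sm_Vmul.

Lemma marked_group_exists :
  exists x : marked_group k, marked_iso (@mg_gen k x) s.
Proof.
have encM : {morph enc : g h / g * h}.
  by move=> g h; rewrite -[RHS]/(sm_mul _ _) /sm_mul !encK.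
have encF : {morph enc : g h / g / h}.
  have enc1 : enc 1 = 1 by [].
  have encV g : enc g^-1 = (enc g)^-1.
    by rewrite -[RHS]/(sm_inv _) /sm_inv encK.
  by move=> g h; rewrite encM encV.
have gen : generates (enc \o s : 'I_k -> small_model).
  move=> A [A1 AB] As w; rewrite -(decK w).
  apply: (sG (A := [pred g | enc g \in A])) => //; split=> [//|g h].
  by rewrite !inE encF; exact: AB.
exists (@MarkedGroup k small_model (Group.class small_model) _ gen).
apply: marked_iso_sym; exists enc; split=> //.
by exists dec.
Qed.

End SmallModel.

(* The space M_k of marked k-generated groups. *)
Definition marked_space (k : nat) : Type := {eq_quot @marked_equiv k}.

HB.instance Definition _ k := Choice.on (marked_space k).
HB.instance Definition _ k := EqQuotient.on (marked_space k).

Section MarkedSpace.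
Variable k : nat.
Implicit Types p q : marked_space k.

(* The distance between p and q is at most 2^-N. *)
Definition marked_close (N : nat) p q : Prop := ball_iso N (repr p) (repr q).

Lemma marked_close_pi N (x y : marked_group k) :
  marked_close N (\pi_(marked_space k) x) (\pi_(marked_space k) y) <->
  ball_iso N x y.
Proof.
have reprP z : ball_iso N z (repr (\pi_(marked_space k) z)).
  apply: marked_iso_ball_iso.
  have /eqP := reprK (\pi_(marked_space k) z).
  by rewrite eq_sym (pi_eq_quot _ _) => /asboolP.
split=> [xy|xy].
  exact: ball_iso_trans (ball_iso_trans (reprP x) xy) (ball_iso_sym (reprP y)).
exact: ball_iso_trans (ball_iso_trans (ball_iso_sym (reprP x)) xy) (reprP y).
Qed.

Definition marked_entourage : set_system (marked_space k * marked_space k) :=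
  filter_from [set: nat] (fun N => [set pq | marked_close N pq.1 pq.2]).

Lemma marked_entourage_filter : Filter marked_entourage.
Proof.
apply: filter_from_filter; first by exists 0%N.
move=> m n _ _; exists (maxn m n) => // -[p q] /= pq.
by split; apply: ball_iso_mono pq; rewrite ?leq_maxl ?leq_maxr.
Qed.

Lemma marked_entourage_diagonal A :
  marked_entourage A -> diagonal `<=` A.
Proof.
move=> [N _ NA] [p q] /= pq; apply: NA; rewrite /diagonal /= in pq *.
by rewrite pq; exact: ball_iso_refl.
Qed.

Lemma marked_entourage_inv A :
  marked_entourage A -> marked_entourage (A^-1)%relation.
Proof.
move=> [N _ NA]; exists N => // -[p q] /= pq; apply: NA => /=.
exact: ball_iso_sym.
Qed.

Lemma marked_entourage_split A : marked_entourage A ->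
  exists2 B, marked_entourage B & (B \; B)%relation `<=` A.
Proof.
move=> [N _ NA]; exists [set pq | marked_close N pq.1 pq.2]; first by exists N.
move=> [p q] /= [r pr rq]; apply: NA; exact: ball_iso_trans pr rq.
Qed.

End MarkedSpace.

(* The uniformity, hence the topology, of the ultrametric: the entourages are
   the supersets of the sets [d(p, q) <= 2^-N]. *)
HB.instance Definition _ k := @isUniform.Build (marked_space k)
  (@marked_entourage k) (@marked_entourage_filter k)
  (@marked_entourage_diagonal k) (@marked_entourage_inv k)
  (@marked_entourage_split k).

Definition perfect_kernel (X : topologicalType) : set X :=
  [set x | forall U : set X, open_nbhs x U -> ~ countable U].

(* The marked group x is any representative with small carrier of the
   isomorphism class (G, s). *)
Definition condensation_group (G : groupType) : Prop :=
  exists (k : nat) (s : 'I_k -> G),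
    [/\ (0 < k)%N, generates s &
        exists2 x : marked_group k, marked_iso (@mg_gen k x) s &
          perfect_kernel (\pi_(marked_space k) x)].

Section Lamplighter.
Import GRing.Theory.
Local Open Scope ring_scope.

Definition lamps_pred : {pred int -> 'Z_2} :=
  fun f => `[< finite_set [set i | f i != 0] >].

Lemma lamps_pred_zmod_closed : zmod_closed lamps_pred.
Proof.
split.
  by apply/asboolP; apply: (@sub_finite_set _ _ set0) => // i /= /eqP; apply.
move=> f g /asboolP ff /asboolP fg; apply/asboolP.
have : finite_set ([set i | f i != 0] `|` [set i | g i != 0]).
  by rewrite finite_setU.
apply: sub_finite_set => i /=; case: (eqVneq (f i) 0) => [fi|]; last by left.
case: (eqVneq (g i) 0) => [gi|]; last by right.
by rewrite -[_ i]/(f i - g i) fi gi subr0 eqxx.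
Qed.

HB.instance Definition _ :=
  GRing.isZmodClosed.Build (int -> 'Z_2) lamps_pred lamps_pred_zmod_closed.

(* The direct sum of copies of Z_2 indexed by Z. *)
Record lamps : Type := Lamps {
  lamps_fun :> int -> 'Z_2;
  lamps_finite_support : lamps_fun \in lamps_pred
}.

HB.instance Definition _ := [isSub for lamps_fun].
HB.instance Definition _ := [Choice of lamps by <:].
HB.instance Definition _ := [SubChoice_isSubZmodule of lamps by <:].

Lemma shift_finite_support (m : int) (f : lamps) : (fun i => f (i - m)) \in lamps_pred.
Proof.
apply/asboolP; case: f => f /= /asboolP ff.
apply: (sub_finite_set _ (finite_image (fun i => i + m) ff)) => i /= fi.
by exists (i - m) => //; rewrite subrK.
Qed.

Definition shift (m : int) (f : lamps) : lamps := Lamps (shift_finite_support m f).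

Lemma shiftD m f g : shift m (f + g) = shift m f + shift m g.
Proof. exact: val_inj. Qed.

Lemma shift0 f : shift 0 f = f.
Proof. by apply: val_inj; apply/funext => i /=; rewrite subr0. Qed.

Lemma shift_comp m n f : shift m (shift n f) = shift (m + n) f.
Proof. by apply: val_inj; apply/funext => i /=; rewrite opprD addrA. Qed.

(* The semidirect product of [lamps] and Z for the action [shift]. *)
Definition lamplighter : Type := (lamps * int)%type.

HB.instance Definition _ := Choice.on lamplighter.

Definition lamplighter_mul (a b : lamplighter) : lamplighter :=
  (a.1 + shift a.2 b.1, a.2 + b.2).
Definition lamplighter_one : lamplighter := (0, 0).
Definition lamplighter_inv (a : lamplighter) : lamplighter :=
  (shift (- a.2) (- a.1), - a.2).

Lemma lamplighter_mulA : associative lamplighter_mul.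
Proof.
by move=> a b c; rewrite /lamplighter_mul /= shiftD shift_comp !addrA.
Qed.

Lemma lamplighter_mul1 : left_id lamplighter_one lamplighter_mul.
Proof. by case=> f m; rewrite /lamplighter_mul /= shift0 !add0r. Qed.

Lemma lamplighter_1mul : right_id lamplighter_one lamplighter_mul.
Proof.
case=> f m; rewrite /lamplighter_mul /= !addr0; congr pair.
rewrite (_ : shift m 0 = 0) ?addr0 //; exact: val_inj.
Qed.

Lemma lamplighter_mulV :
  left_inverse lamplighter_one lamplighter_inv lamplighter_mul.
Proof.
case=> f m; rewrite /lamplighter_mul /= -shiftD !addNr; congr pair.
exact: val_inj.
Qed.

Lemma lamplighter_Vmul :
  right_inverse lamplighter_one lamplighter_inv lamplighter_mul.
Proof.
by case=> f m; rewrite /lamplighter_mul /= shift_comp !subrr shift0 subrr.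
Qed.

HB.instance Definition _ := isGroup.Build lamplighter
  lamplighter_mulA lamplighter_mul1 lamplighter_1mul
  lamplighter_mulV lamplighter_Vmul.

End Lamplighter.

(* Main.v *)
(* A function chi : Z -> Z_2 defines a shift-invariant bilinear Z_2-valued form on
   the lamps, hence a 2-cocycle and a central extension of L by Z_2, in which
   the lamps at 0 and d commute if and only if chi d = chi (- d).  If chi
   vanishes on [-(N + 1), N + 1], then no word of length at most N + 1 sees the
   centre, so that the extension and L have the same ball of radius N.  The
   functions chi supported on integers > N + 1 thus give continuum many distinct
   marked groups at distance at most 2^-N from L. *)
Require Import Defs.
From HB Require Import structures.
From mathcomp Require Import all_boot all_order all_algebra.
From mathcomp Require Import all_classical.
From mathcomp Require Import topology.
From mathcomp Require Import zify.
Set Implicit Arguments.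
Unset Strict Implicit.
Unset Printing Implicit Defensive.
Import GRing.Theory.

Local Open Scope classical_set_scope.
Local Open Scope ring_scope.

(** * Words in marked groups and the balls they determine *)

Section Words.
Variable k : nat.
Local Open Scope group_scope.

Lemma word_val_cons (G : groupType) (s : 'I_k -> G) l w :
  word_val s (l :: w) = letter s l * word_val s w.
Proof. by rewrite /word_val big_cons. Qed.

Lemma word_val_cat (G : groupType) (s : 'I_k -> G) u v :
  word_val s (u ++ v) = word_val s u * word_val s v.
Proof. by rewrite /word_val big_cat. Qed.

Lemma word_val_nseq (G : groupType) (s : 'I_k -> G) n l :
  word_val s (nseq n l) = letter s l ^+ n.
Proof.
elim: n => [|n IH]; first by rewrite /word_val big_nil.
by rewrite word_val_cons IH expgS.
Qed.

Lemma morph_word_val (G H : groupType) (s : 'I_k -> G) (t : 'I_k -> H)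
    (f : G -> H) : {morph f : g h / g * h} -> (forall i, f (s i) = t i) ->
  forall w, f (word_val s w) = word_val t w.
Proof.
move=> fM fs.
have f1 : f 1 = 1 by apply: (mulgI (f 1)); rewrite -fM !mulg1.
have fV g : f g^-1 = (f g)^-1 by apply: (mulgI (f g)); rewrite -fM !mulgV f1.
elim=> [|[i b] w IH]; first by rewrite /word_val !big_nil.
by rewrite !word_val_cons fM IH /letter /=; case: b; rewrite ?fV fs.
Qed.

Lemma marked_iso_word (G H : groupType) (s : 'I_k -> G) (t : 'I_k -> H) u v :
  marked_iso s t ->
  word_val s u = word_val s v <-> word_val t u = word_val t v.
Proof.
move=> [f [fb fM fs]]; rewrite -!(morph_word_val fM fs).
by split=> [->//|]; exact: (bij_inj fb).
Qed.

(** An edge inside the ball of radius N is an equality between a word of length at most N + 1 and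
    one of length at most N. Hence the equalities between words of length up to N + 1 determine the
    labelled ball. *)
Lemma ball_iso_words N (x y : marked_group k) :
  (forall u v, (size u <= N.+1)%N -> (size v <= N.+1)%N ->
     word_val (@mg_gen k x) u = word_val (@mg_gen k x) v <->
     word_val (@mg_gen k y) u = word_val (@mg_gen k y) v) ->
  ball_iso N x y.
Proof.
move=> xy.
(* A chosen spelling of [g] of length at most N, with default [[::]] outside the ball. By the
   hypothesis, [f] on the ball does not depend on the choice. *)
pose word (g : x) := xget [::]
  [set w | (size w <= N)%N /\ g = word_val (@mg_gen k x) w].
pose f g : y := word_val (@mg_gen k y) (word g).
have fE w : (size w <= N)%N ->
    f (word_val (@mg_gen k x) w) = word_val (@mg_gen k y) w.
  move=> wN; rewrite /f /word; case: xgetP => [v _ [vN]|/(_ w)]; last by case.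
  by move/xy => <- //; exact: leqW.
have f1 : f 1 = 1.
  by have := fE [::] (leq0n N); rewrite /word_val !big_nil.
exists f; split=> //; first split.
- by move=> _ [w wN ->]; exists w => //; exact: fE.
- move=> g h; rewrite !inE => -[u uN ->] [v vN ->].
  by rewrite !fE // => /xy; apply; exact: leqW.
- by move=> _ [w wN ->]; exists (word_val (@mg_gen k x) w); [exists w|exact: fE].
move=> i _ _ [u uN ->] [v vN ->]; rewrite /cayley_edge !fE //.
have E (z : marked_group k) : word_val (@mg_gen k z) u * mg_gen z i =
    word_val (@mg_gen k z) (rcons u (i, false)) by rewrite word_val_rcons.
rewrite !E; apply: xy; first exact: leqW.
by rewrite size_rcons.
Qed.

End Words.

(** * Bilinear forms on the lamps *)

Section Pairing.
Implicit Types (chi : int -> 'Z_2) (f g h : lamps).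

Lemma Z2P (x : 'Z_2) : x = 0 \/ x = 1.
Proof. by case: x => -[|[|//]] i; [left|right]; exact: val_inj. Qed.

Lemma lamps_support f :
  exists2 s : seq int, uniq s & forall i, f i != 0 -> i \in s.
Proof.
have /asboolP/finite_seqP[s fs] := lamps_finite_support f.
exists (undup s); first exact: undup_uniq.
move=> i fi; rewrite mem_undup.
by have : [set` s] i by rewrite -fs.
Qed.

(** Summing over all of Z with finite support avoids choosing a list; [pairingE] gives back the sum
    over any duplicate-free list containing the support of [f]. *)
Definition pairing chi f : 'Z_2 := \sum_(i \in [set: int]) chi i * f i.

Lemma pairingE chi f (s : seq int) : uniq s -> (forall i, f i != 0 -> i \in s) ->
  pairing chi f = \sum_(i <- s) chi i * f i.
Proof.
move=> us fs; rewrite /pairing (fsbigE s) //.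
  by apply: eq_bigl => i; rewrite in_setT.
by move=> i _ /=; case: (eqVneq (f i) 0) => [->|/fs ->//]; rewrite mulr0.
Qed.

Lemma eq_pairing chi chi' f : chi =1 chi' -> pairing chi f = pairing chi' f.
Proof. by move=> /funext ->. Qed.

Lemma pairingDr chi f g : pairing chi (f + g) = pairing chi f + pairing chi g.
Proof.
have [s _ fs] := lamps_support f; have [t _ gt] := lamps_support g.
have su := undup_uniq (s ++ t).
rewrite !(@pairingE _ _ (undup (s ++ t))) //.
- by rewrite -big_split; apply: eq_bigr => i _; exact: mulrDr.
- by move=> i gi; rewrite mem_undup mem_cat gt ?orbT.
- by move=> i fi; rewrite mem_undup mem_cat fs.
- move=> i; rewrite mem_undup mem_cat -[(f + g) i]/(f i + g i).
  case: (eqVneq (f i) 0) => [->|/fs -> //]; rewrite add0r => /gt ->.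
  by rewrite orbT.
Qed.

Lemma pairingDl chi chi' f :
  pairing (fun i => chi i + chi' i) f = pairing chi f + pairing chi' f.
Proof.
have [s us fs] := lamps_support f; rewrite !(pairingE _ us fs) -big_split.
by apply: eq_bigr => i _; exact: mulrDl.
Qed.

Lemma pairing0 chi : pairing chi 0 = 0.
Proof. by apply: (addrI (pairing chi 0)); rewrite -pairingDr !addr0. Qed.

Lemma pairing_eq0 chi f : (forall i, f i != 0 -> chi i = 0) -> pairing chi f = 0.
Proof.
move=> cf; rewrite /pairing fsbig1 // => i _.
by case: (eqVneq (f i) 0) => [->|/cf->]; rewrite ?mulr0 ?mul0r.
Qed.

Lemma pairing_shift chi m f :
  pairing chi (shift m f) = pairing (fun i => chi (i + m)) f.
Proof.
rewrite /pairing (reindex_fsbigT (fun i => i + m)) /=.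
  by apply: eq_fsbigr => i _; rewrite addrK.
by exists (fun i => i - m) => i; rewrite ?addrK ?subrK.
Qed.

Lemma delta_finite_support (m : int) : (fun i => (i == m)%:R) \in lamps_pred.
Proof.
apply/asboolP; apply: (@sub_finite_set _ _ [set m]) => // i /=.
by case: (eqVneq i m) => // _ /eqP.
Qed.

Definition delta m : lamps := Lamps (delta_finite_support m).

Lemma deltaE m i : delta m i = (i == m)%:R. Proof. by []. Qed.

Lemma shift_0 m : shift m 0 = 0.
Proof. exact: val_inj. Qed.

Lemma shift_delta m n : shift m (delta n) = delta (n + m).
Proof.
by apply: val_inj; apply/funext => i /=; rewrite subr_eq.
Qed.

Lemma pairing_delta chi m : pairing chi (delta m) = chi m.
Proof.
rewrite (@pairingE _ _ [:: m]) //; first by rewrite big_seq1 deltaE eqxx mulr1.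
by move=> i; rewrite deltaE inE; case: (eqVneq i m) => //; rewrite eqxx.
Qed.

(** The bilinear form whose matrix in the basis of single lamps is the Toeplitz matrix chi (i -
    j). *)
Definition cocycle chi f g := pairing (fun i => pairing (fun j => chi (i - j)) g) f.

Lemma cocycleDl chi f g h : cocycle chi (f + g) h = cocycle chi f h + cocycle chi g h.
Proof. exact: pairingDr. Qed.

Lemma cocycleDr chi f g h : cocycle chi f (g + h) = cocycle chi f g + cocycle chi f h.
Proof.
by rewrite /cocycle -pairingDl; apply: eq_pairing => i; rewrite pairingDr.
Qed.

Lemma cocycle0l chi g : cocycle chi 0 g = 0. Proof. exact: pairing0. Qed.

Lemma cocycle0r chi f : cocycle chi f 0 = 0.
Proof. by apply: (addrI (cocycle chi f 0)); rewrite -cocycleDr !addr0. Qed.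

Lemma cocycleNl chi f g : cocycle chi (- f) g = - cocycle chi f g.
Proof. by apply: (addrI (cocycle chi f g)); rewrite -cocycleDl !subrr cocycle0l. Qed.

Lemma cocycleNr chi f g : cocycle chi f (- g) = - cocycle chi f g.
Proof. by apply: (addrI (cocycle chi f g)); rewrite -cocycleDr !subrr cocycle0r. Qed.

(** The matrix entry depends only on i - j. This invariance is what makes the product of the
    extension associative in the presence of shifts. *)
Lemma cocycle_shift chi m f g : cocycle chi (shift m f) (shift m g) = cocycle chi f g.
Proof.
rewrite /cocycle pairing_shift; apply: eq_pairing => i.
by rewrite pairing_shift; apply: eq_pairing => j; rewrite opprD addrACA subrr addr0.
Qed.

Lemma cocycle_delta chi m n : cocycle chi (delta m) (delta n) = chi (m - n).
Proof. by rewrite /cocycle !pairing_delta. Qed.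

End Pairing.

(* The argument, unused in the carrier, selects the group law. *)
Definition twisted (chi : int -> 'Z_2) : Type := (lamps * 'Z_2 * int)%type.

HB.instance Definition _ chi := Choice.on (twisted chi).

(** * The central extension of the lamplighter group attached to chi *)

Section Twisted.
Variable chi : int -> 'Z_2.

(** A Heisenberg-type extension of the lamps by Z_2, on which Z acts by shifting the lamps and
    fixing the central coordinate. *)
Definition twisted_mul (a b : twisted chi) : twisted chi :=
  (a.1.1 + shift a.2 b.1.1,
   a.1.2 + b.1.2 + cocycle chi a.1.1 (shift a.2 b.1.1), a.2 + b.2).
Definition twisted_one : twisted chi := (0, 0, 0).
(** The central coordinate x solves c + x + cocycle f (- f) = 0. *)
Definition twisted_inv (a : twisted chi) : twisted chi :=
  (shift (- a.2) (- a.1.1), cocycle chi a.1.1 a.1.1 - a.1.2, - a.2).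

Lemma twisted_mulA : associative twisted_mul.
Proof.
move=> [[f c] m] [[g d] n] [[h e] p]; rewrite /twisted_mul /=.
rewrite shiftD -shift_comp cocycleDl cocycleDr cocycle_shift !addrA.
congr (_, _, _); rewrite -!addrA; do 2 congr (_ + _).
by rewrite [RHS]addrCA; congr (_ + _); rewrite addrC -addrA.
Qed.

Lemma twisted_mul1 : left_id twisted_one twisted_mul.
Proof.
by move=> [[f c] m]; rewrite /twisted_mul /= shift0 cocycle0l addr0 !add0r.
Qed.

Lemma twisted_1mul : right_id twisted_one twisted_mul.
Proof.
by move=> [[f c] m]; rewrite /twisted_mul /= shift_0 cocycle0r !addr0.
Qed.

Lemma twisted_mulV : left_inverse twisted_one twisted_inv twisted_mul.
Proof.
move=> [[f c] m]; rewrite /twisted_mul /= -shiftD cocycle_shift cocycleNl.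
by rewrite subrK subrr !addNr shift_0.
Qed.

Lemma twisted_Vmul : right_inverse twisted_one twisted_inv twisted_mul.
Proof.
move=> [[f c] m]; rewrite /twisted_mul /= shift_comp subrr shift0 cocycleNr.
by rewrite subrr addrCA subrr addr0 subrr.
Qed.

HB.instance Definition _ := isGroup.Build (twisted chi)
  twisted_mulA twisted_mul1 twisted_1mul twisted_mulV twisted_Vmul.

Definition twist (f : lamps) (c : 'Z_2) (m : int) : twisted chi := (f, c, m).

Lemma twistM f c m g d n : (twist f c m * twist g d n)%g =
  twist (f + shift m g) (c + d + cocycle chi f (shift m g)) (m + n).
Proof. by []. Qed.

Lemma twistV f c m :
  ((twist f c m)^-1)%g = twist (shift (- m) (- f)) (cocycle chi f f - c) (- m).
Proof. by []. Qed.

Lemma twist_translation m n : (twist 0 0 m * twist 0 0 n)%g = twist 0 0 (m + n).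
Proof. by rewrite twistM shift_0 cocycle0l !addr0. Qed.

Lemma twist_translationV m : ((twist 0 0 m)^-1)%g = twist 0 0 (- m).
Proof. by rewrite twistV oppr0 shift_0 cocycle0l subr0. Qed.

Lemma twist_translationX (n : nat) : ((twist 0 0 1) ^+ n)%g = twist 0 0 n%:Z.
Proof. by elim: n => [//|n IH]; rewrite expgS IH twist_translation -intS. Qed.

Lemma twist_conj m f c :
  (twist 0 0 m * twist f c 0 * (twist 0 0 m)^-1)%g = twist (shift m f) c 0.
Proof.
rewrite twist_translationV !twistM !shift_0 cocycle0l cocycle0r.
by rewrite !addr0 !add0r subrr.
Qed.

Definition lamp m : twisted chi := twist (delta m) 0 0.

Lemma lampM m n :
  (lamp m * lamp n)%g = twist (delta m + delta n) (chi (m - n)) 0.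
Proof. by rewrite twistM shift0 cocycle_delta !add0r. Qed.

Lemma lamp_commute m n :
  (lamp m * lamp n)%g = (lamp n * lamp m)%g <-> chi (m - n) = chi (n - m).
Proof. by rewrite !lampM addrC; split=> [[]|->]. Qed.

Lemma lamp_conj m n :
  (twist 0 0 m * lamp n * (twist 0 0 m)^-1)%g = lamp (n + m).
Proof. by rewrite twist_conj shift_delta. Qed.

Definition twisted_gen (i : 'I_2) : twisted chi :=
  if i == 0%N :> nat then lamp 0 else twist 0 0 1.

(** Conjugating the lamp at 0 by translations yields every lamp. The lamps at d and 0 do not
    commute, so their commutator is the nontrivial central element; an induction on the support then
    reaches all configurations. *)
Lemma twisted_gen_generates d : chi d != chi (- d) -> generates twisted_gen.
Proof.
move=> chid A Agr As.
have [A1 _] := Agr; have AV := group_closedV Agr; have AM := group_closedM Agr.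
have At m : twist 0 0 m \in A.
  have tn (n : nat) : twist 0 0 n%:Z \in A.
    elim: n => [//|n /(AM _ _ (As ord_max))].
    by rewrite twist_translation -intS.
  by case: m => n //; have := AV _ (tn n.+1); rewrite twist_translationV NegzE.
have Alamp m : lamp m \in A.
  rewrite -[m]add0r -lamp_conj.
  exact: (AM _ _ (AM _ _ (At m) (As ord0)) (AV _ (At m))).
have Az : twist 0 1 0 \in A.
  suff -> : twist 0 1 0 = (lamp d * lamp 0 * (lamp 0 * lamp d)^-1)%g.
    exact: (AM _ _ (AM _ _ (Alamp d) (Alamp 0))
                   (AV _ (AM _ _ (Alamp 0) (Alamp d)))).
(* What remains is chi d = 1 + chi (- d), true in Z_2 because the two values differ. *)
apply/esym/eqP; rewrite divg_eq !lampM twistM shift0 cocycle0l add0r addrC.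
  rewrite subr0 sub0r addr0 [_ + chi _]addrC -(subrK (chi (- d)) (chi d)).
  case: (Z2P (chi d - chi (- d))) => [/eqP|->]; first by rewrite subr_eq0 (negPf chid).
  by rewrite [1 + _]addrC.
have Acenter c : twist 0 c 0 \in A by case: (Z2P c) => ->.
have Alamps f c : twist f c 0 \in A.
  have [s us fs] := lamps_support f.
  elim: s us f fs c => [_ f fs c|i s IH /andP[nis us] f fs c].
    suff -> : f = 0 by [].
    apply: val_inj; apply/funext => i; apply/eqP; apply: contraT => /fs.
    by rewrite in_nil.
  case: (Z2P (f i)) => fi.
    apply: IH => // j fj; have := fs j fj; rewrite inE => /orP[/eqP ji|//].
    by rewrite ji fi eqxx in fj.
  (* Lamp i is split off, and the central coordinate is corrected by the cocycle that the product
     creates. *)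
  have -> : twist f c 0 = (lamp i *
      twist (f - delta i) (c - cocycle chi (delta i) (f - delta i)) 0)%g.
    by rewrite twistM shift0 addr0 add0r subrK addrC subrK.
  apply: (AM _ _ (Alamp i)); apply: IH => // j.
  rewrite -[(f - delta i) j]/(f j - delta i j) deltaE.
  case: (eqVneq j i) => [->|ji]; first by rewrite fi subrr eqxx.
  by rewrite subr0 => /fs; rewrite inE (negPf ji).
move=> [[f c] m]; have := AM _ _ (Alamps f c) (At m).
by rewrite twistM shift_0 cocycle0r !addr0 add0r.
Qed.

Definition twisted_proj (a : twisted chi) : lamplighter := (a.1.1, a.2).

Lemma twisted_projM : {morph twisted_proj : a b / (a * b)%g}.
Proof. by []. Qed.

Definition lamplighter_gen (i : 'I_2) : lamplighter :=
  if i == 0%N :> nat then (delta 0, 0) else (0, 1).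

Lemma twisted_proj_gen i : twisted_proj (twisted_gen i) = lamplighter_gen i.
Proof. by rewrite /twisted_gen /lamplighter_gen; case: ifP. Qed.

(** Letters are added on the left. A translation moves the support by one and contributes no
    cocycle; a lamp contributes a sum of values chi (- i) over the support of [f], where chi
    vanishes. *)
Lemma word_val_twisted N : (forall i : int, (`|i| <= N)%N -> chi i = 0) ->
  forall w : seq ('I_2 * bool), (size w <= N)%N ->
  exists f m, word_val twisted_gen w = twist f 0 m /\
    forall i, f i != 0 -> (`|i| <= size w)%N.
Proof.
move=> chi0; elim=> [_|[j b] w IH wN].
  by exists 0, 0; rewrite /word_val big_nil.
have [f [m [IH1 IH2]]] := IH (ltnW wN).
rewrite word_val_cons IH1 -[letter _ _]/(if b then (twisted_gen j)^-1%g else _).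
rewrite /twisted_gen.
have chi00 : chi 0 = 0 by exact: chi0.
(* Since chi 0 = 0, the lamp at 0 is an involution, so both signs of its letter are treated at
   once. *)
have lampV : (lamp 0)^-1%g = lamp 0.
  rewrite twistV oppr0 shift0 cocycle_delta subrr chi00 subr0.
  congr twist; apply: val_inj; apply/funext => i /=.
  rewrite -[LHS]/(- ((i == 0)%:R : 'Z_2)); case: (i == 0); exact: val_inj.
case: ((j : nat) == 0%N).
- exists (delta 0 + f), m; rewrite lampV if_same twistM shift0 !add0r; split.
    congr twist; rewrite /cocycle pairing_delta; apply: pairing_eq0 => i /IH2 iw.
    by apply: chi0; rewrite sub0r abszN; exact: leq_trans iw (ltnW wN).
  move=> i; rewrite -[(delta 0 + f) i]/(delta 0 i + f i) deltaE.
  case: (eqVneq i 0) => [-> //|_]; rewrite add0r => /IH2; exact: leqW.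
- have -> : (if b then (twist 0 0 1)^-1%g else twist 0 0 1)
      = twist 0 0 ((-1) ^+ b).
    by rewrite twist_translationV; case: (b).
  exists (shift ((-1) ^+ b) f), ((-1) ^+ b + m).
  rewrite twistM cocycle0l !add0r; split=> // i.
  by rewrite /= => /IH2; case: (b) => /=; lia.
Qed.

(** The projection forgets only the central coordinate, which is 0 on both words. *)
Lemma word_val_twisted_lamplighter N :
  (forall i : int, (`|i| <= N)%N -> chi i = 0) ->
  forall u v, (size u <= N)%N -> (size v <= N)%N ->
  word_val lamplighter_gen u = word_val lamplighter_gen v <->
  word_val twisted_gen u = word_val twisted_gen v.
Proof.
move=> chi0 u v uN vN.
rewrite -!(morph_word_val twisted_projM twisted_proj_gen).
split=> [|->//].
have [f [m [-> _]]] := word_val_twisted chi0 uN.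
by have [g [n [-> _]]] := word_val_twisted chi0 vN => -[-> ->].
Qed.

(** With a the lamp generator and t the translation, this is t^n a t^(-n). It spells the lamp at n
    in every extension at once, so commutation of lamps becomes a relation between fixed words. *)
Definition lamp_word (n : nat) : seq ('I_2 * bool) :=
  nseq n (ord_max, false) ++ (ord0, false) :: nseq n (ord_max, true).

Lemma word_val_lamp_word n : word_val twisted_gen (lamp_word n) = lamp n%:Z.
Proof.
rewrite word_val_cat word_val_cons !word_val_nseq /letter /=.
by rewrite expVgn !twist_translationX mulgA lamp_conj add0r.
Qed.

Lemma lamp_word_commute (n : nat) :
  word_val twisted_gen (lamp_word 0 ++ lamp_word n)
  = word_val twisted_gen (lamp_word n ++ lamp_word 0) <->
  chi (- n%:Z) = chi n%:Z.
Proof.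
rewrite !(word_val_cat _ (lamp_word _)) !word_val_lamp_word.
by have := lamp_commute 0 n%:Z; rewrite sub0r subr0.
Qed.

End Twisted.

(** * Continuum many extensions near the lamplighter group *)

Lemma lamplighter_gen_generates : generates lamplighter_gen.
Proof.
(* Generation passes to the quotient from an extension with chi 1 != chi (- 1). *)
pose chi (i : int) : 'Z_2 := (i == 1)%:R.
have gen : generates (@twisted_gen chi) by exact: (@twisted_gen_generates chi 1).
move=> A [A1 AF] As [f m].
apply: (gen [pred x | twisted_proj x \in A] _ _ (twist chi f 0 m)).
  split=> // x y xA yA; exact: (AF _ _ xA yA).
by move=> i; rewrite inE twisted_proj_gen.
Qed.

(* The value at N + 2 is always 1, so that the centre is generated by
   commutators of lamps whatever J is. *)
Definition twisting N (J : nat -> bool) (i : int) : 'Z_2 :=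
  if i is Posz n then
    ((n == N.+2) || (N.+2 < n)%N && J (n - N.+3)%N)%:R
  else 0.

(** The bound is N + 1 because [ball_iso_words] compares words of that length for balls of radius
    N. *)
Lemma twisting_small N J i : (`|i| <= N.+1)%N -> twisting N J i = 0.
Proof.
case: i => // n /= nN; rewrite ltnNge (leqW nN) orbF.
by rewrite ltn_eqF.
Qed.

Lemma twisting_generates N J : generates (@twisted_gen (twisting N J)).
Proof.
by apply: (@twisted_gen_generates _ (Posz N.+2)); rewrite /twisting eqxx.
Qed.

Lemma twistingE N J n : twisting N J (N.+3 + n)%N = (J n)%:R.
Proof.
rewrite /twisting addKn.
have -> : (N.+3 + n == N.+2)%N = false by lia.
by have -> : (N.+2 < N.+3 + n)%N by lia.
Qed.

(** A marked isomorphism preserves relations between words. As [twisting] vanishes at negative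
    integers, the lamps at 0 and N + 3 + n commute exactly when J n is false, so the relations
    recover J. *)
Lemma twisting_inj N J J' :
  marked_iso (@twisted_gen (twisting N J)) (@twisted_gen (twisting N J')) ->
  J = J'.
Proof.
move=> JJ'; apply/funext => n; apply: negb_inj.
have E K : word_val (@twisted_gen (twisting N K)) (lamp_word 0 ++ lamp_word (N.+3 + n))
  = word_val (@twisted_gen (twisting N K)) (lamp_word (N.+3 + n) ++ lamp_word 0)
  <-> ~~ K n.
  apply: (iff_trans (lamp_word_commute _ _)); rewrite twistingE.
  rewrite (_ : twisting N K _ = 0) //.
  by case: (K n); split.
by apply/idP/idP => /E/(marked_iso_word _ _ JJ')/E.
Qed.

Lemma uncountable_cantor_image (T : Type) (A : set T) (f : (nat -> bool) -> T) :
  injective f -> (forall J, A (f J)) -> ~ countable A.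
Proof.
move=> fI fA /countable_injP[e eI].
pose code J := e (f J).
have codeI : injective code.
  by move=> J K /eI; rewrite !inE => /(_ (fA J) (fA K)) /fI.
(* Cantor's diagonal: at n it negates the sequence coded by n, if there is one. *)
pose D n := `[< forall J, code J = n -> ~~ J n >].
have [DD|nDD] := boolP (D (code D)).
  by move: (DD) => /asboolP/(_ D erefl); rewrite DD.
by move: (nDD) => /negP[]; apply/asboolP => J /codeI ->.
Qed.

Lemma nbhs_marked_close k (p : marked_space k) (U : set (marked_space k)) :
  nbhs p U -> exists N, forall q, marked_close N p q -> U q.
Proof.
rewrite -nbhs_entourageE => -[E [N _ NE] EU].
by exists N => q pq; apply: EU; apply/xsectionP; apply: NE.
Qed.

Theorem corollary1 : condensation_group lamplighter.
Proof.
exists 2, lamplighter_gen; split=> //; first exact: lamplighter_gen_generates.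
have [x xL] := marked_group_exists lamplighter_gen_generates; exists x => //.
move=> U /open_nbhs_nbhs/nbhs_marked_close[N NU].
(* Each extension is replaced by an isomorphic model with small carrier, to be a point of the
   space. *)
have y_ex J := marked_group_exists (@twisting_generates N J).
pose y J : marked_group 2 := sval (cid (y_ex J)).
have yP J : marked_iso (@mg_gen 2 (y J)) (@twisted_gen (twisting N J)).
  by rewrite /y; case: cid.
apply: (@uncountable_cantor_image _ _ (fun J => \pi_(marked_space 2) (y J))%qT).
  move=> J K /eqP; rewrite (pi_eq_quot _ _) => /asboolP yJK.
  apply: (@twisting_inj N); apply: marked_iso_trans (yP K).
  exact: marked_iso_trans (marked_iso_sym (yP J)) yJK.
move=> J; apply: NU; apply/marked_close_pi/ball_iso_words => u v uN vN.
(* Word equalities are carried from the model [x] to the lamplighter group, then to the extension,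
   then to its model [y J]. *)
apply: (iff_trans (marked_iso_word u v xL)).
apply: iff_trans (iff_sym (marked_iso_word u v (yP J))).
by apply: (word_val_twisted_lamplighter _ uN vN); exact: twisting_small.
Qed.
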